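(* For $n\ge1$, \begin{align*} D_{n}(p,q,t)&=\sum_{k=0}^{\lfloor (n-1)/2\rfloor} \mathrm{d}_{n,k}(p,q)\,t^k =\sum_{\sigma\in \mathfrak{D}_{n}}p^{\operatorname{res}\sigma}q^{\operatorname{les}\sigma-\operatorname{des}\sigma}t^{\operatorname{des}\sigma}. \end{align*}
   Context: Let $[n]_{p,q}=\sum_{i+j=n-1}p^iq^j$ and $\binom{n}{k}_{p,q}=\frac{[n]_{p,q}\cdots[n-k+1]_{p,q}}{[1]_{p,q}\cdots[k]_{p,q}}$. The polynomials $D_n(p,q,t)$ are defined by the continued fraction $\sum_{n\ge0}D_{n+1}(p,q,t)x^n=\cfrac{1}{1-[1]_{p,q}x-\cfrac{\binom{2}{2}_{p,q}t\,x^2}{1-[2]_{p,q}x-\cfrac{\binom{3}{2}_{p,q}t\,x^2}{1-[3]_{p,q}x-\cdots}}}$ (J-fraction with $b_m=[m+1]_{p,q}$, $\lambda_m=\binom{m+1}{2}_{p,q}t$). For a permutation $\sigma=\sigma_1\ldots\sigma_n$ of $[n]$: $\operatorname{des}\sigma$ is the number of $i<n$ with $\sigma_i>\sigma_{i+1}$; $\operatorname{les}\sigma$ is the number of pairs $(i,j)$ with $2\le i<j\le n$ and $\sigma_{i-1}>\sigma_j>\sigma_i$; $\operatorname{res}\sigma$ is the number of pairs $(i,j)$ with $1\le i<j\le n-1$ and $\sigma_{j+1}>\sigma_i>\sigma_j$. With $\sigma_0=\sigma_{n+1}=0$, $\sigma_i$ is a double descent if $\sigma_{i-1}>\sigma_i>\sigma_{i+1}$.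 $\sigma_{[k]}$ is the subword of $\sigma$ formed by $1,\dots,k$; $\sigma$ is an André permutation if for every $1\le k\le n$, $\sigma_{[k]}$ has no double descents and ends with an ascent. $\mathfrak{D}_n$ is the set of André permutations of $[n]$, $\mathfrak{D}_{n,k}$ those with $k$ descents, and $\mathrm{d}_{n,k}(p,q)=\sum_{\sigma\in\mathfrak{D}_{n,k}}p^{\operatorname{res}\sigma}q^{\operatorname{les}\sigma-k}$. *)

(* Defs.v *)
From HB Require Import structures.
From mathcomp Require Import all_boot all_order all_algebra all_fingroup.
From mathcomp Require Import fraction.
From mathcomp.multinomials Require Import mpoly.

Set Implicit Arguments.
Unset Strict Implicit.
Unset Printing Implicit Defensive.

Import GRing.Theory.
Local Open Scope ring_scope.

(* p, q, t are the three indeterminates of Z[p, q, t], seen in its field of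
   fractions so that the (p,q)-binomial coefficients are genuine quotients and
   les - des is a genuine (untruncated) integer exponent. *)
Definition Kpqt : fieldType := {fraction {mpoly int[3]}}.
Definition p : Kpqt := tofrac ('X_(@Ordinal 3 0 isT) : {mpoly int[3]}).
Definition q : Kpqt := tofrac ('X_(@Ordinal 3 1 isT) : {mpoly int[3]}).
Definition t : Kpqt := tofrac ('X_(@Ordinal 3 2 isT) : {mpoly int[3]}).

Definition pqnum (n : nat) : Kpqt :=
  \sum_(i < n) \sum_(j < n | (i + j).+1 == n) p ^+ i * q ^+ j.

Definition pqbinom (n k : nat) : Kpqt :=
  (\prod_(i < k) pqnum (n - i)) / (\prod_(i < k) pqnum i.+1).

Section ContinuedFraction.
Variable K : fieldType.

(* A formal power series in x is its sequence of coefficients. *)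
Definition fps := nat -> K.

Definition fps_mul (f g : fps) : fps := fun n => \sum_(i < n.+1) f i * g (n - i)%N.

Definition fps_one : fps := fun n => (n == 0%N)%:R.

(* The first n coefficients of 1 / f, by the usual recurrence. *)
Fixpoint fps_inv_seq (f : fps) (n : nat) : seq K :=
  if n is m.+1 then
    let s := fps_inv_seq f m in
    rcons s ((f 0%N)^-1 * ((m == 0%N)%:R - \sum_(i < m) s`_i * f (m - i)%N))
  else [::].

Definition fps_inv (f : fps) : fps := fun n => (fps_inv_seq f n.+1)`_n.

Lemma size_fps_inv_seq f n : size (fps_inv_seq f n) = n.
Proof. by elim: n => //= n IHn; rewrite size_rcons IHn. Qed.

Lemma fps_inv_seqE f n i : (i < n)%N -> (fps_inv_seq f n)`_i = fps_inv f i.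
Proof.
elim: n => // n IHn; rewrite ltnS leq_eqVlt => /orP[/eqP-> //|lt_in].
by rewrite /= nth_rcons size_fps_inv_seq lt_in IHn.
Qed.

Lemma fps_invE f n : fps_inv f n =
  (f 0%N)^-1 * ((n == 0%N)%:R - \sum_(i < n) fps_inv f i * f (n - i)%N).
Proof.
rewrite {1}/fps_inv /= nth_rcons size_fps_inv_seq ltnn eqxx.
by congr (_ * (_ - _)); apply: eq_bigr => i _; rewrite fps_inv_seqE.
Qed.

Lemma fps_mulVf f : f 0%N != 0 -> fps_mul (fps_inv f) f =1 fps_one.
Proof.
move=> f0 n; rewrite /fps_mul big_ord_recr /= subnn [fps_inv f n]fps_invE.
by rewrite mulrAC mulVf // mul1r addrC subrK.
Qed.

Lemma eq_fps_inv f g n :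
  (forall i, (i <= n)%N -> f i = g i) -> fps_inv f n = fps_inv g n.
Proof.
elim/ltn_ind: n => n IHn eq_fg; rewrite !fps_invE eq_fg //.
congr (_ * (_ - _)); apply: eq_bigr => i _.
rewrite eq_fg ?leq_subr // IHn // => j le_ji.
by rewrite eq_fg // (leq_trans le_ji) // ltnW.
Qed.

(* 1 - b x - l x^2 G(x) *)
Definition Jdenom (b l : K) (G : fps) : fps := fun n =>
  match n with 0 => 1 | 1 => - b | k.+2 => - (l * G k) end.

(* The tail of the J-fraction that starts at level m, cut after N levels:
   1/(1 - b_m x - l_(m+1) x^2/(1 - b_(m+1) x - l_(m+2) x^2/(1 - ... ))). *)
Fixpoint Jconv (b l : nat -> K) (N m : nat) : fps :=
  if N is N'.+1 then fps_inv (Jdenom (b m) (l m.+1) (Jconv b l N' m.+1))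
  else fun=> 0.

(* The infinite J-fraction is the x-adic limit of its convergents: by
   Jconv_stable the coefficient of x^n is constant from depth n.+1 on. *)
Definition Jfrac (b l : nat -> K) : fps := fun n => Jconv b l n.+1 0 n.

Lemma Jconv_stable b l N m n : (n < N)%N -> Jconv b l N m n = Jconv b l n.+1 m n.
Proof.
suff stab M M' : (n < M)%N -> (n < M')%N -> Jconv b l M m n = Jconv b l M' m n.
  by move=> ltnN; apply: stab.
elim: M M' n m => // M IHM [|M'] // n m ltnM ltnM'.
apply: eq_fps_inv => -[|[|i]] //= lt_in.
by congr (- (_ * _)); apply: IHM; apply: leq_trans (ltnW lt_in) _.
Qed.

End ContinuedFraction.

(* For n >= 1; the value at 0 is irrelevant. *)
Definition D (n : nat) : Kpqt :=
  Jfrac (fun m => pqnum m.+1) (fun m => pqbinom m.+1 2 * t) n.-1.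

Section Words.
Implicit Type w : seq nat.

(* 1-based letters of w, with the conventions w_0 = w_(size w + 1) = 0. *)
Definition letter w (i : nat) : nat := nth 0%N (0%N :: w) i.

Definition des w : nat :=
  (\sum_(1 <= i < size w) (letter w i > letter w i.+1))%N.

Definition les w : nat :=
  (\sum_(2 <= i < (size w).+1) \sum_(i.+1 <= j < (size w).+1)
     (letter w i < letter w j < letter w i.-1))%N.

Definition res w : nat :=
  (\sum_(1 <= i < size w) \sum_(i.+1 <= j < size w)
     (letter w j < letter w i < letter w j.+1))%N.

Definition double_descent w (i : nat) : bool :=
  (letter w i.+1 < letter w i < letter w i.-1)%N.

(* A word of length 1 ends with an ascent, since w_0 = 0 < w_1. *)
Definition ends_with_ascent w : bool :=
  (letter w (size w).-1 < letter w (size w))%N.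

Definition subword w (k : nat) : seq nat := [seq x <- w | (1 <= x <= k)%N].

Definition andre w : bool :=
  all (fun k => let v := subword w k in
         ~~ has (double_descent v) (iota 1 (size v)) && ends_with_ascent v)
      (iota 1 (size w)).

End Words.

(* The word of a permutation of 'I_n, shifted to the alphabet {1, ..., n}. *)
Definition word (n : nat) (s : 'S_n) : seq nat := [seq (s i : nat).+1 | i : 'I_n].

Definition Andre (n : nat) : {set 'S_n} := [set s | andre (word s)].

Definition Andre_des (n k : nat) : {set 'S_n} :=
  [set s in Andre n | des (word s) == k].

Definition d (n k : nat) : Kpqt :=
  \sum_(s in Andre_des n k)
     p ^+ res (word s) * q ^ ((les (word s))%:Z - k%:Z).

(* Main.v *)
Require Import Defs.
From mathcomp Require Import all_boot all_order all_algebra all_fingroup.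
From mathcomp Require Import fraction zify ring.
From mathcomp.multinomials Require Import mpoly.

Set Implicit Arguments.
Unset Strict Implicit.
Unset Printing Implicit Defensive.

Import GRing.Theory.

(** Read the letters of a permutation in increasing order.  Replacing every
    maximal run of letters [>= k] by a single hole, the letter [k] is put into
    some hole: it fills it (peak), keeps a hole on its right (double ascent) or
    splits it in two (valley).  With [g] holes on the left of that hole and [g']
    on its right, [k] plays the role of the letter 2 in [g] patterns 31-2 and [g']
    patterns 2-13, which gives the factor [q^g p^g'].

    The permutation is André iff whenever a valley splits a hole, the right half
    is used before the left one; until then the left half is blocked.  The
    weights of two neighbouring holes are in the ratio [p : q], so each
    blocked hole multiplies the generating function of all completions by
    [q / (p + q)].  Hence this function depends only on the number of holes and
    of blocked holes; with the factor [t / q] of a valley, an up step gets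
    [t / (p + q)], and the weighted Motzkin paths so obtained are those of the
    J-fraction. *)

Local Open Scope nat_scope.

(** * Double descents and André words *)

(* [x] is the letter preceding [w]; [w] is followed by the letter [0]. *)
Fixpoint no_dd (x : nat) (w : seq nat) : bool :=
  if w is y :: v then ~~ (head 0 v < y < x) && no_dd y v else true.

Lemma no_ddE x w :
  no_dd x w = ~~ has (fun i => nth 0 (x :: w) i.+1 < nth 0 (x :: w) i
                               < nth 0 (x :: w) i.-1) (iota 1 (size w)).
Proof.
elim: w x => //= y w IHw x; rewrite negb_or IHw -nth0.
rewrite (iotaDl 1 1 (size w)) has_map; congr (_ && ~~ _); apply: eq_in_has => -[|i].
  by rewrite mem_iota.
by [].
Qed.

Lemma no_dd_word w : no_dd 0 w = ~~ has (double_descent w) (iota 1 (size w)).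
Proof. exact: no_ddE. Qed.

Lemma no_dd_le x y w : x <= y -> no_dd y w -> no_dd x w.
Proof. by case: w => //= z w le_xy /andP[ndd ->]; rewrite andbT; lia. Qed.

Lemma no_dd_catr x a b : no_dd x (a ++ b) -> no_dd (last x a) b.
Proof. by elim: a x => //= y a IHa x /andP[_ /IHa]. Qed.

(** The default [0] plays the final letter [0]. A larger letter put in front of such a word turns
    its first letter into a double descent. *)
Definition head_dd (w : seq nat) : bool := nth 0 w 1 < nth 0 w 0.

Lemma no_dd_max k x a b : all (ltn^~ k) (x :: a) ->
  no_dd x (a ++ k :: b) -> ~~ head_dd b || (k <= head 0 b).
Proof.
move=> ltk /no_dd_catr /=; case: b => [|y [|z b]] //=; rewrite /head_dd /=; lia.
Qed.

(** Only the neighbourhood of [k] changes: [k] follows a smaller letter, the letter before [k] now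
    ascends, and the letter after [k] does not start a descent. *)
Lemma no_dd_insert k x a b :
  x < k -> all (ltn^~ k) a -> all (ltn^~ k) b -> ~~ head_dd b ->
  no_dd x (a ++ b) -> no_dd x (a ++ k :: b).
Proof.
move=> ltxk lt_a lt_b ddb; elim: a x ltxk lt_a => [|y a IHa] x ltxk /=.
  move=> _; case: b lt_b ddb => [|y b] /=; first by rewrite /head_dd; lia.
  by rewrite /head_dd /= nth0; lia.
move=> /andP[lt_yk lt_a] /andP[ndd /(IHa _ lt_yk lt_a) ->]; rewrite andbT.
by case: a lt_a ndd {IHa} => [|z a] /=; lia.
Qed.

Definition andre_word (w : seq nat) := forall j, no_dd 0 [seq x <- w | x <= j].

Lemma andre_word_insert k a b : 0 < k ->
  all (ltn^~ k) a -> all (ltn^~ k) b -> ~~ head_dd b ->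
  andre_word (a ++ b) -> andre_word (a ++ k :: b).
Proof.
move=> k_gt0 lt_a lt_b ddb aab j; have := aab j.
rewrite !filter_cat /=; case: leqP => // lekj.
have fid c : all (ltn^~ k) c -> [seq x <- c | x <= j] = c.
  by move=> /allP lt_c; apply/all_filterP/allP => x /lt_c /=; lia.
by rewrite !fid //; apply: no_dd_insert.
Qed.

Lemma perm_iota_gt0 w n : perm_eq w (iota 1 n) -> {in w, forall x, 0 < x <= n}.
Proof. by move=> /perm_mem wE x; rewrite wE mem_iota; lia. Qed.

Lemma andreP n w : perm_eq w (iota 1 n) -> reflect (andre_word w) (andre w).
Proof.
move=> wn; have w_gt0 := perm_iota_gt0 wn.
have szw : size w = n by rewrite (perm_size wn) size_iota.
have uw : uniq w by rewrite (perm_uniq wn) iota_uniq.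
have subE k : subword w k = [seq x <- w | x <= k].
  by apply: eq_in_filter => x /w_gt0; lia.
apply: (iffP allP) => [aw j | aw k].
  case: (posnP j) => [->|j_gt0].
    by rewrite (eq_in_filter (a2 := pred0)) ?filter_pred0 // => x /w_gt0 /=; lia.
  have [lejn|ltnj] := leqP j n.
    have /= := aw j; rewrite mem_iota szw subE -no_dd_word.
    by move=> /(_ _)/andP[|//]; lia.
  have -> : [seq x <- w | x <= j] = [seq x <- w | x <= n].
    by apply: eq_in_filter => x /w_gt0; lia.
  have /= := aw n; rewrite mem_iota szw subE -no_dd_word.
  case: (posnP n) => [n0|n_gt0]; last by move=> /(_ _)/andP[|//]; lia.
  by rewrite (size0nil (etrans szw n0)).
rewrite mem_iota szw => kn /=; rewrite subE -no_dd_word aw /=.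
(* Final ascent: the letter [1] makes the subword nonempty, and a descent onto its last letter
   would, with the final [0], make that letter a double descent. *)
have : 1 \in [seq x <- w | x <= k].
  by rewrite mem_filter (perm_mem wn) mem_iota; lia.
have : all (ltn 0) [seq x <- w | x <= k].
  by apply/allP => x; rewrite mem_filter => /andP[_ /w_gt0 /andP[]].
have := filter_uniq (fun x => x <= k) uw; move: (aw k).
case/lastP: [seq x <- w | x <= k] => // v y ndd uvy pvy _.
rewrite /ends_with_ascent /letter size_rcons /= nth_rcons ltnn eqxx.
case/lastP: v ndd uvy pvy => [|v x] ndd uvy pvy.
  by move: pvy; rewrite /= andbT.
move: uvy ndd pvy; rewrite !size_rcons /= !rcons_uniq mem_rcons inE negb_or.
rewrite nth_rcons size_rcons leqnn nth_rcons ltnn eqxx => /andP[/andP[neq _] _].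
rewrite -cats1 => /no_dd_catr; rewrite last_rcons /= all_cat /= => ndd.
by move=> /andP[_]; lia.
Qed.

Lemma andre_no_dd n w : perm_eq w (iota 1 n) -> andre w -> no_dd 0 w.
Proof.
move=> wn /(andreP wn)/(_ n).
by rewrite (all_filterP _) //; apply/allP => x /(perm_iota_gt0 wn) /andP[].
Qed.

(** Two consecutive positions are never both descents, and the final [0] adds a descent at position
    [n]. Summing [D i + D i.+1 <= 1] over [i < n] gives [2 * des w + 1 <= n]. *)
Lemma des_andre_le n w : 0 < n -> perm_eq w (iota 1 n) -> andre w ->
  des w <= (n - 1) %/ 2.
Proof.
move=> n_gt0 wn aw; have := andre_no_dd wn aw.
have szw : size w = n by rewrite (perm_size wn) size_iota.
rewrite no_dd_word => /hasPn ndd.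
pose D i := (letter w i > letter w i.+1 : nat).
have le1 i : i < n -> D i + D i.+1 <= 1.
  move=> lt_in; have := ndd i.+1; rewrite mem_iota szw /double_descent /= /D.
  move=> /(_ _); move: (letter w i) (letter w i.+1) (letter w i.+2); lia.
have : \sum_(0 <= i < n) (D i + D i.+1) <= n.
  rewrite -[X in _ <= X]mul1n -[X in _ <= _ * X]subn0 mulnC -sum_nat_const_nat.
  by rewrite !big_nat; apply: leq_sum => i /andP[_ /le1].
have -> : \sum_(0 <= i < n) (D i + D i.+1)
    = D 0 + \sum_(1 <= i < n) D i + (\sum_(1 <= i < n) D i + D n).
  by rewrite big_split /= big_ltn // -(big_add1 _ _ 0 n.+1 xpredT D) big_nat_recr.
have -> : D n = 1.
  have wn0 : 0 < nth 0 w n.-1.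
    have /(perm_iota_gt0 wn) : nth 0 w n.-1 \in w by rewrite mem_nth // szw; lia.
    by lia.
  rewrite /D /letter /= nth_default ?szw //; case: n n_gt0 wn0 {wn szw le1} => //= n _ ->.
  by [].
have -> : \sum_(1 <= i < n) D i = des w by rewrite /des szw.
lia.
Qed.

(** * The statistics, letter by letter *)

(** When [w] is what precedes [k], these are the patterns 31-2 with [k] as the letter 2. The default
    [k] rules out the last letter of [w]. *)
Fixpoint desc_across (k : nat) (w : seq nat) : nat :=
  if w is x :: v then (head k v < k < x) + desc_across k v else 0.

Fixpoint asc_across (k : nat) (w : seq nat) : nat :=
  if w is x :: v then (x < k < head k v) + asc_across k v else 0.

Lemma desc_acrossE k w :
  \sum_(2 <= i < (size w).+1) (letter w i < k < letter w i.-1) = desc_across k w.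
Proof.
elim: w => [|x w IHw]; first by rewrite big_geq.
rewrite /= -IHw; case: w {IHw} => [|y w] /=; first by rewrite !big_geq //=; lia.
rewrite big_ltn // big_add1 /=; congr (_ + _).
by rewrite !big_nat; apply: eq_bigr => -[|[|i]].
Qed.

Lemma asc_acrossE k w :
  \sum_(1 <= j < size w) (letter w j < k < letter w j.+1) = asc_across k w.
Proof.
elim: w => [|x w IHw]; first by rewrite big_geq.
rewrite /= -IHw; case: w {IHw} => [|y w] /=; first by rewrite !big_geq //=; lia.
rewrite big_ltn // big_add1 /=; congr (_ + _).
by rewrite !big_nat; apply: eq_bigr => -[|i].
Qed.

Lemma les_rcons w x : les (rcons w x) = les w + desc_across x w.
Proof.
rewrite /les size_rcons -desc_acrossE.
have letE i : i <= size w -> letter (rcons w x) i = letter w i.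
  by case: i => // i lt_iw; rewrite /letter /= nth_rcons lt_iw.
have letx : letter (rcons w x) (size w).+1 = x.
  by rewrite /letter /= nth_rcons ltnn eqxx.
have [w0|w_gt0] := posnP (size w); first by rewrite w0 !big_geq.
rewrite big_nat_recr //= [X in _ + X = _]big_geq // addn0 -big_split /=.
rewrite !big_nat; apply: eq_bigr => i /andP[i_gt1 lt_i].
rewrite big_nat_recr //= letx !letE; try lia; congr (_ + _).
by rewrite !big_nat; apply: eq_bigr => j /andP[_ lt_j]; rewrite !letE; lia.
Qed.

Lemma res_cons x w : res (x :: w) = asc_across x w + res w.
Proof.
rewrite /res -asc_acrossE /=.
have [w0|w_gt0] := posnP (size w); first by rewrite w0 !big_geq.
rewrite big_ltn //=; congr (_ + _).
  by rewrite big_add1 /= !big_nat; apply: eq_bigr => -[|i].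
rewrite big_add1 /= !big_nat; apply: eq_bigr => -[|i] // _.
by rewrite big_add1 /= !big_nat; apply: eq_bigr => -[|j].
Qed.

Lemma les_sum w :
  les w = \sum_(i < size w) desc_across (nth 0 w i) (take i w).
Proof.
elim/last_ind: w => [|w x IHw]; first by rewrite /les /= !big_geq // big_ord0.
rewrite les_rcons IHw size_rcons big_ord_recr /= nth_rcons ltnn eqxx.
rewrite -cats1 take_size_cat //; congr (_ + _); apply: eq_bigr => i _.
by rewrite nth_cat ltn_ord takel_cat // ltnW.
Qed.

Lemma res_sum w :
  res w = \sum_(i < size w) asc_across (nth 0 w i) (drop i.+1 w).
Proof.
elim: w => [|x w IHw]; first by rewrite /res /= !big_geq // big_ord0.
by rewrite res_cons IHw /= big_ord_recl /= drop0; congr (_ + _).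
Qed.

(** Each descent is charged to its bottom; the default [0] leaves out the first letter. *)
Lemma des_sum w :
  des w = \sum_(i < size w) (nth 0 w i < last 0 (take i w)).
Proof.
rewrite /des; case: w => [|x w]; first by rewrite !big_geq // big_ord0.
rewrite /= big_ord_recl /= add0n big_add1 /= big_mkord; apply: eq_bigr => i _.
rewrite /letter /= add0n (last_nth 0) size_takel; last exact: ltnW.
by rewrite -[x :: take i w]/(take i.+1 (x :: w)) nth_take.
Qed.

Lemma sum_letters n w (F : nat -> nat -> nat) : perm_eq w (iota 1 n) ->
  \sum_(i < size w) F (nth 0 w i) i = \sum_(1 <= k < n.+1) F k (index k w).
Proof.
move=> wn; have uw : uniq w by rewrite (perm_uniq wn) iota_uniq.
rewrite /index_iota subn1 /= -(perm_big _ wn) (big_nth 0) big_mkord.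
by apply: eq_bigr => i _; rewrite index_uniq.
Qed.

(* In what follows [u] is a word with holes, a hole being the letter [0]. *)
Definition letters (u : seq nat) : seq nat := [seq x <- u | x != 0].

Definition holes (u : seq nat) : nat := count_mem 0 u.

Definition starts_hole (u : seq nat) : bool := head 1 u == 0.

Definition ends_hole (u : seq nat) : bool := last 1 u == 0.

Fixpoint shadow (k : nat) (w : seq nat) : seq nat :=
  if w is x :: v then
    let u := shadow k v in
    if x < k then x :: u else if starts_hole u then u else 0 :: u
  else [::].

(** Holes touching [k] are parts of the hole that [k] enters, so they must not be counted:
    [strip_hole] removes the one on its right, and [rholes] skips the one on its left. *)
Definition strip_hole (u : seq nat) : seq nat :=
  if starts_hole u then behead u else u.

Fixpoint rholes (u : seq nat) : nat :=
  if u is x :: v then ((x == 0) && (v != [::])) + rholes v else 0.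

(** Inverse of an insertion: a letter between [u] and [v] and the holes touching it become one
    hole. *)
Fixpoint merge_hole (u v : seq nat) : seq nat :=
  if u is x :: u' then
    if (x == 0) && (u' == [::]) then 0 :: strip_hole v else x :: merge_hole u' v
  else 0 :: strip_hole v.

Fixpoint spread (u : seq nat) : bool :=
  if u is x :: v then ~~ ((x == 0) && starts_hole v) && spread v else true.

(** At stage [k] the letter [k] and the runs touching it form one hole; at stage [k.+1] it separates
    them ([shadowS_split]). *)
Lemma shadow_merge k w1 w2 : all (ltn 0) w1 ->
  shadow k (w1 ++ k :: w2) = merge_hole (shadow k w1) (shadow k w2).
Proof.
elim: w1 => [|x w1 IHw] /=.
  rewrite ltnn /strip_hole /starts_hole.
  by case: (shadow k w2) => [|[|y] u].
move=> /andP[x_gt0 /IHw ->]; case: ifP => [lt_xk|_] /=.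
  by case: eqP => //= x0; rewrite x0 in x_gt0.
by case: (shadow k w1) => [|[|y] [|z u]].
Qed.

Lemma shadowS k w : k \notin w -> shadow k.+1 w = shadow k w.
Proof.
elim: w => //= x w IHw; rewrite inE negb_or => /andP[neq_kx /IHw ->].
by rewrite ltnS leq_eqVlt eq_sym (negbTE neq_kx).
Qed.

Lemma shadowS_split k w1 w2 : 0 < k -> k \notin w1 -> k \notin w2 ->
  shadow k.+1 (w1 ++ k :: w2) = shadow k w1 ++ k :: shadow k w2.
Proof.
move=> k_gt0; elim: w1 => [|x w1 IHw] /= k1 k2; first by rewrite ltnSn shadowS.
move: k1; rewrite inE negb_or => /andP[neq_kx k1]; rewrite IHw // ltnS leq_eqVlt.
rewrite eq_sym (negbTE neq_kx) /=; case: ifP => // lt_xk.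
by rewrite /starts_hole; case: (shadow k w1) => [|y u] //=; case: ifP => //; lia.
Qed.

Lemma shadow_lt k w : 0 < k -> all (ltn^~ k) (shadow k w).
Proof.
move=> k_gt0; elim: w => //= x w IHw.
by case: ifP => /= [->|_] //; case: ifP => //=; rewrite k_gt0.
Qed.

Lemma spread_shadow k w : all (ltn 0) w -> spread (shadow k w).
Proof.
elim: w => //= x w IHw /andP[x_gt0 /IHw sw].
case: ifP => /= _; first by rewrite sw andbT; case: x x_gt0.
by case: ifP => //= ->; rewrite sw.
Qed.

Lemma letters_shadow k w : all (ltn 0) w ->
  letters (shadow k w) = [seq x <- w | x < k].
Proof.
rewrite /letters; elim: w => //= x w IHw /andP[x_gt0 /IHw sw].
case: ifP => /= _; last by case: ifP => //=; rewrite sw.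
by case: x x_gt0 => //= x _; rewrite sw.
Qed.

Lemma starts_hole_shadow k w : 0 < k -> all (ltn 0) w ->
  starts_hole (shadow k w) = (k <= head 0 w).
Proof.
rewrite /starts_hole; case: w => [|x w] /=; first by lia.
move=> k_gt0 /andP[x_gt0 _]; case: ltnP => _ /=; first by lia.
by case: ifP.
Qed.

Lemma shadow_nil k w : (shadow k w == [::]) = (w == [::]).
Proof.
case: w => //= x w; rewrite /starts_hole; case: ifP => // _.
by case: (shadow k w) => //= y u; case: ifP.
Qed.

Lemma ends_hole_shadow k w : 0 < k -> all (ltn 0) w ->
  ends_hole (shadow k w) = (k <= last 0 w).
Proof.
move=> k_gt0; rewrite /ends_hole.
elim: w => [|x w IHw] /=; first by lia.
move=> /andP[x_gt0 w_gt0]; move: (IHw w_gt0) (shadow_nil k w).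
case: w w_gt0 {IHw} => [|y w] /=.
  by move=> *; case: ltnP => /=; lia.
move: (if y < k then _ else _) => -[|z u] // _ <- _.
by case: ifP => // _; case: ifP.
Qed.

(** A hole followed by something is a run of letters above [k] followed by a letter below [k], that
    is, one descent across [k]. *)
Lemma desc_across_shadow k w : 0 < k -> all (ltn 0) w -> k \notin w ->
  desc_across k w = rholes (shadow k w).
Proof.
move=> k_gt0; elim: w => //= x w IHw /andP[x_gt0 w_gt0].
rewrite inE negb_or => /andP[neq_kx kw]; rewrite IHw //.
move: (shadow_nil k w) (starts_hole_shadow k_gt0 w_gt0).
case: w w_gt0 kw {IHw} => [|y w] /=; first by case: ifP; rewrite /= ?andbF; lia.
rewrite inE negb_or => /andP[y_gt0 _] /andP[neq_ky _].
move: (if y < k then _ else _) => u u_neq0 ->.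
case: (ltnP x k) => [lt_xk|le_kx] /=; first by lia.
by case: (leqP k y) => /=; rewrite ?u_neq0 /=; lia.
Qed.

Lemma asc_across_shadow k w : 0 < k -> all (ltn 0) w -> k \notin w ->
  asc_across k w = holes (strip_hole (shadow k w)).
Proof.
move=> k_gt0; elim: w => //= x w IHw /andP[x_gt0 w_gt0].
rewrite inE negb_or => /andP[neq_kx kw]; rewrite IHw //.
move: (shadow_nil k w) (starts_hole_shadow k_gt0 w_gt0).
have -> : (x < k < head k w) = (x < k) && (k <= head 0 w).
  case: w w_gt0 kw {IHw} => [|y w] /=; first by lia.
  by rewrite inE negb_or => /andP[y_gt0 _] /andP[neq_ky _]; lia.
move=> _ <-; rewrite /strip_hole.
case: (ltnP x k) => [lt_xk|le_kx] /=.
  have -> : starts_hole (x :: shadow k w) = false by rewrite /starts_hole /=; lia.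
  rewrite /starts_hole /holes /=; case: (shadow k w) => [|[|y] u] /=; lia.
by case: ifP => // su; rewrite ?su // /starts_hole /= add0n.
Qed.

(** * Insertion of a letter into a hole *)

(* Whether the hole preceding [u] is blocked: a letter larger than all those of
   [u] put into it would turn the first letter of [u] into a double descent. *)
Definition blocked (u : seq nat) : bool := head_dd (letters u).

Fixpoint nblocked (u : seq nat) : nat :=
  if u is x :: v then ((x == 0) && blocked v) + nblocked v else 0.

(* No letter following a hole is bound to become a double descent. *)
Fixpoint valleys_ok (u : seq nat) : bool :=
  if u is x :: v then
    [&& (x == 0) ==> (if v is y :: l then (y < head 0 l) || starts_hole l else true)
      & valleys_ok v]
  else true.

Section Insertions.
Variables (K : fieldType) (P Q T : K).

(* The words obtained by putting the new maximum [k] into an unblocked hole of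
   [u], with their weights; [m] is the number of holes on the left of [u]. *)
Fixpoint insertions (k m : nat) (u : seq nat) : seq (K * seq nat) :=
  if u is x :: v then
    (if (x == 0) && ~~ blocked v then
       let c := (Q ^+ m * P ^+ holes v)%R in
       [:: (c, k :: v); (c, k :: 0 :: v); ((c * (T / Q))%R, 0 :: k :: 0 :: v)]
     else [::])
    ++ [seq (z.1, x :: z.2) | z <- insertions k (m + (x == 0)) v]
  else [::].

Lemma insertionsP k m u z : z \in insertions k m u -> exists a s,
  [/\ u = a ++ 0 :: s, ~~ blocked s &
      z.2 \in [:: a ++ k :: s; a ++ k :: 0 :: s; a ++ 0 :: k :: 0 :: s]].
Proof.
elim: u m z => //= x u IHu m z; rewrite mem_cat => /orP[|/mapP[y /IHu]].
  case: ifP => // /andP[/eqP-> bu]; rewrite !inE => H.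
  exists [::], u; split=> //.
  by case/or3P: H => /eqP-> /=; rewrite !inE eqxx ?orbT.
move=> [a [s [-> bs ys]]] ->; exists (x :: a), s; split=> //=.
by move: ys; rewrite !inE /= !eqseq_cons !eqxx.
Qed.

Lemma head_letters_insertions k m u z : 0 < k -> z \in insertions k m u ->
  head 0 (letters z.2) = head 0 (letters u) \/ head 0 (letters z.2) = k.
Proof.
case: k => // k _ /insertionsP[a [s [-> bs]]]; rewrite /letters.
by rewrite !inE => /or3P[]/eqP->; rewrite !filter_cat /=;
  case: [seq x <- a | x != 0]; auto.
Qed.

Lemma head_insertions k m u z : ~~ starts_hole u -> z \in insertions k m u ->
  head 0 (letters z.2) = head 0 (letters u).
Proof.
case: u => //= -[|x] u // _; rewrite mem_cat /= => /mapP[y _ ->] //.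
Qed.

(** The first letter stays in place, and its successor either stays the same or becomes the larger
    letter [k]. *)
Lemma blocked_insertions k m u z : all (ltn^~ k) u -> ~~ starts_hole u ->
  ~~ blocked u -> z \in insertions k m u -> ~~ blocked z.2.
Proof.
case: u => // x u /= /andP[lt_xk lt_u]; case: x lt_xk => // x lt_xk _ bu.
move=> /mapP[y yu ->] /=; move: bu; rewrite /blocked /letters /head_dd /= !nth0.
have k_gt0 : 0 < k by lia.
by case: (head_letters_insertions k_gt0 yu); rewrite /letters => -> //; lia.
Qed.

Lemma spread_insert k a s : 0 < k -> spread (a ++ 0 :: s) ->
  [/\ spread (a ++ k :: s), spread (a ++ k :: 0 :: s)
    & spread (a ++ 0 :: k :: 0 :: s)].
Proof.
case: k => // k _; elim: a => [|x a IHa] /=.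
  by rewrite /starts_hole /= => /andP[-> ->].
move=> /andP[xa /IHa[-> -> ->]]; move: xa; rewrite /starts_hole.
by case: a {IHa} => [|y a] /=; case: (x == 0) => //= ->.
Qed.

(** A letter whose right neighbour was the chosen hole is now followed by [k], which is larger, or
    still by a hole. A new [k] preceded by a hole is also followed by one. *)
Lemma valleys_ok_insert k a s : 0 < k -> all (ltn^~ k) a ->
  spread (a ++ 0 :: s) -> valleys_ok (a ++ 0 :: s) ->
  [/\ valleys_ok (a ++ k :: s), valleys_ok (a ++ k :: 0 :: s)
    & valleys_ok (a ++ 0 :: k :: 0 :: s)].
Proof.
case: k => // k _; elim: a => [|x a IHa] /=.
  by move=> _ _ /andP[vs ->]; rewrite vs /starts_hole.
move=> /andP[_ lt_a] /andP[xs sa] /andP[xa /(IHa lt_a sa)[-> -> ->]]; move: xa xs lt_a.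
rewrite /starts_hole; case: a {IHa sa} => [|y [|z a]] /=; last by move=> ->.
  by rewrite eqxx andbT => _ /negbTE->.
by rewrite andbT => _ _ ->; rewrite implybT.
Qed.

(* Invariant of the shadows [shadow k w] of the André words [w]. *)
Record state (k : nat) (u : seq nat) : Prop := State {
  state_perm : perm_eq (letters u) (iota 1 k.-1);
  state_spread : spread u;
  state_valleys : valleys_ok u;
  state_andre : andre_word (letters u) }.

Lemma state_lt k u : 0 < k -> state k u -> all (ltn^~ k) u.
Proof.
move=> k_gt0 [uk _ _ _]; apply/allP => x xu /=; case: (posnP x) => [->//|x_gt0].
have : x \in letters u by rewrite mem_filter xu andbT; lia.
by rewrite (perm_mem uk) mem_iota; lia.
Qed.

Lemma state_insertions k m u z : 0 < k -> state k u ->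
  z \in insertions k m u -> state k.+1 z.2.
Proof.
move=> k_gt0 su; have := state_lt k_gt0 su; case: su => pu spu vu au lt_u.
move=> /insertionsP[a [s [uE bs zE]]]; rewrite {u}uE in pu spu vu au lt_u.
move: lt_u; rewrite all_cat /= => /and3P[lt_a _ lt_s].
have lE : letters z.2 = letters a ++ k :: letters s.
  move: zE; rewrite /letters !inE => /or3P[]/eqP->; rewrite !filter_cat /=;
  by have -> : (k != 0) by lia.
have ltl b : all (ltn^~ k) b -> all (ltn^~ k) (letters b).
  by move=> /allP lt_b; apply/allP => x; rewrite mem_filter => /andP[_ /lt_b].
have [sp1 sp2 sp3] := spread_insert k_gt0 spu.
have [v1 v2 v3] := valleys_ok_insert k_gt0 lt_a spu vu.
split; rewrite ?lE.
- move: pu; rewrite /letters filter_cat /= => pu.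
  have -> : iota 1 k.+1.-1 = iota 1 k.-1 ++ [:: k].
    by rewrite -[k.+1.-1](prednK k_gt0) -[k.-1.+1]addn1 iotaD /= add1n prednK.
  by rewrite perm_catC perm_sym perm_catC /= perm_cons perm_sym perm_catC.
- by move: zE; rewrite !inE => /or3P[]/eqP->.
- by move: zE; rewrite !inE => /or3P[]/eqP->.
apply: andre_word_insert; rewrite ?ltl //.
by move: au; rewrite /letters filter_cat.
Qed.

Local Open Scope ring_scope.

(** At most one insertion yields a given word, and its type is read off the holes touching [k]: it
    is a valley exactly when [pre] ends with a hole, and otherwise [post] tells a double ascent from
    a peak. *)
Lemma sum_insertions_eq k m u pre post : (0 < k)%N ->
  all (ltn^~ k) pre -> all (ltn^~ k) u ->
  spread pre -> spread post -> spread u ->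
  (ends_hole pre -> starts_hole post) -> ~~ blocked (strip_hole post) ->
  \sum_(z <- insertions k m u) z.1 * (pre ++ k :: post == z.2)%:R
  = Q ^+ (m + rholes pre) * P ^+ holes (strip_hole post) * (T / Q) ^+ ends_hole pre
    * (merge_hole pre post == u)%:R.
Proof.
move=> k_gt0; elim: pre m u => [|y pre IHpre] m [|x u] /=; 
  rewrite ?big_nil ?big_cat ?big_map /=.
- by rewrite mulr0.
- move=> _ /andP[lt_xk _] _ spost /andP[xu su] _ bpost; rewrite mulr1.
  rewrite [X in _ + X = _]big1 ?addr0; last first.
    by move=> z _; rewrite eqseq_cons gtn_eqF //= mulr0.
  rewrite eqseq_cons [0%N == x]eq_sym.
  case: eqP xu => [x0|_] /= xu; last by rewrite big_nil mulr0.
  (* The two cases are a peak and a double ascent. *)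
  have -> : (strip_hole post == u) = (post == u) || (post == 0%N :: u).
    move: xu spost; rewrite /strip_hole /starts_hole.
    case: post {bpost} => [|[|b] v] /=; rewrite ?orbF //.
      by case: u {su} => [|[|c] u] /=; rewrite // eqseq_cons eqxx ?orbF.
  case bu: (blocked u) => /=.
    rewrite big_nil; case: orP => [H|]; rewrite ?mulr0 //; exfalso.
    move: bpost; suff -> : strip_hole post = u by rewrite bu.
    by case: H => /eqP->; rewrite /strip_hole ?(negbTE xu).
  rewrite !big_cons big_nil /= !eqseq_cons !eqxx /= [k == 0%N]gtn_eqF //= mulr0 !addr0.
  have [->|neq] := eqVneq post u => /=.
    rewrite (_ : (u == 0%N :: u) = false) ?mulr0 ?addr0 ?addn0 /strip_hole ?(negbTE xu) //.
    by apply/negP => /eqP /(congr1 size) /=; lia.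
  have [->|neq'] := eqVneq post (0%N :: u) => /=; rewrite ?mulr0 ?addr0 //.
  by rewrite add0r /strip_hole /= addn0 !mulr1.
- by case: ifP; rewrite mulr0.
move=> /andP[lt_yk lt_pre] /andP[lt_xk lt_u] /andP[ypre spre] spost /andP[xu su].
move=> epre bpost.
have [y0|y_neq0] := eqVneq y 0%N; last first.
  rewrite /= (_ : ends_hole (y :: pre) = ends_hole pre); last first.
    by case: (pre) => //; rewrite /ends_hole /= (negbTE y_neq0).
  rewrite [X in X + _]big1_seq ?add0r; last first.
    move=> z /andP[_]; case: ifP => // _; rewrite !inE => /or3P[]/eqP-> /=;
      by rewrite eqseq_cons ?(negbTE y_neq0) ?ltn_eqF //= mulr0.
  rewrite eqseq_cons; have [yx|neq_yx] := eqVneq y x; last first.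
    by rewrite mulr0 big1 // => z _; rewrite eqseq_cons (negbTE neq_yx) mulr0.
  rewrite -yx (negbTE y_neq0) addn0 /= -IHpre //; last first.
    by move: epre; rewrite /ends_hole; case: (pre) => //=; case: (post).
  by apply: eq_bigr => z _; rewrite eqseq_cons eqxx.
subst y; rewrite /=.
have [x0|x_neq0] := eqVneq x 0%N; last first.
  rewrite /= big_nil add0r big1 => [|z _]; last first.
    by rewrite eqseq_cons eq_sym (negbTE x_neq0) mulr0.
  by case: ifP => _; rewrite eqseq_cons eq_sym (negbTE x_neq0) mulr0.
subst x; rewrite /= in xu *.
have mapE : \sum_(j <- insertions k (m + 1) u)
      j.1 * (0%N :: pre ++ k :: post == 0%N :: j.2)%:R
    = \sum_(j <- insertions k (m + 1) u) j.1 * (pre ++ k :: post == j.2)%:R.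
  by apply: eq_bigr => z _; rewrite eqseq_cons eqxx.
(* A hole immediately before [k] is the left half of a split hole; any other one is passed over and
   adds one to the exponent of [Q]. *)
case: pre => [|y pre] in IHpre lt_pre ypre spre epre mapE *.
  rewrite mapE IHpre //= !eqseq_cons /=.
  have -> : (0%N :: strip_hole post == u) = false.
    by case: (u) xu => // -[|c] v.
  rewrite !mulr0 addr0 addn0.
  have /epre spo : ends_hole [:: 0%N] by [].
  case: post spo spost bpost {epre IHpre mapE} => [|[|b] r] // _ spost bpost.
  rewrite /strip_hole /= in bpost *.
  have [ru|neq] := eqVneq r u; last first.
    rewrite mulr0 big1_seq // => z /andP[_]; case: ifP => // _.
    rewrite !inE => /or3P[]/eqP-> /=; rewrite !eqseq_cons ?(ltn_eqF k_gt0) /= ?mulr0 //.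
    by rewrite (negbTE neq) andbF mulr0.
  rewrite -ru bpost !big_cons big_nil /= !eqseq_cons !(ltn_eqF k_gt0) !eqxx /=.
  by rewrite !mulr0 !add0r !mulr1 addr0 addn0 expr1.
rewrite /= !eqseq_cons eqxx /= mapE IHpre // addn1 !addSnnS.
rewrite big1_seq ?add0r // => z /andP[_]; case: ifP => // _.
move: lt_pre; rewrite /= => /andP[lt_y _].
rewrite !inE => /or3P[]/eqP-> /=; rewrite !eqseq_cons ?(ltn_eqF k_gt0) /= ?mulr0 //.
by rewrite (ltn_eqF lt_y) mulr0.
Qed.

(** The index [g] is the number of holes on the left of the chosen one among [n] holes. *)
Definition pq_number (n : nat) : K := \sum_(g < n) Q ^+ g * P ^+ (n.-1 - g).

Lemma pq_numberS n : pq_number n.+1 = P ^+ n + Q * pq_number n.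
Proof.
rewrite /pq_number big_ord_recl /= subn0 expr0 mul1r mulr_sumr; congr (_ + _).
by apply: eq_bigr => i _; rewrite /bump /= add1n exprS -mulrA; congr (_ * (_ * _ ^+ _)); lia.
Qed.

(** The holes are read from the left. An unblocked one contributes its three insertions; in the
    valley the left half is blocked, whence [T / Q * (Q / (P + Q)) = T / (P + Q)]. A blocked one is
    treated together with the next hole, through [Q^(m+1) P^h = Q / (P + Q) * (Q^m P^(h+1) + Q^(m+1)
    P^h)]. *)
Lemma sum_insertions k m u (G : nat -> K) : (0 < k)%N -> Q != 0 -> P + Q != 0 ->
  all (ltn^~ k) u -> spread u -> valleys_ok u -> no_dd 0 (letters u) ->
  \sum_(z <- insertions k m u)
     z.1 * ((Q / (P + Q)) ^+ nblocked z.2 * G (m + holes z.2)%N)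
  = (Q / (P + Q)) ^+ nblocked u * (Q ^+ m * pq_number (holes u))
    * (G (m + holes u).-1 + G (m + holes u)%N
       + T / (P + Q) * G (m + holes u).+1).
Proof.
move=> k_gt0 Q_neq0 PQ_neq0.
have [N] := ubnP (size u); elim: N u m => // N IHN [|x u] m.
  by rewrite /= big_nil /pq_number big_ord0 !(mulr0, mul0r).
rewrite ltnS /= => lt_uN /andP[lt_xk lt_u] /andP[xu su] /andP[vxu vu] ndd.
rewrite big_cat big_map /=.
have [x0|x_neq0] := eqVneq x 0%N; last first.
  rewrite /= big_nil add0r addn0 !add0n -IHN //.
  by move: ndd; rewrite x_neq0 => /andP[_]; apply: no_dd_le.
subst x; rewrite /= in xu vxu *; rewrite {lt_xk}.
have {}ndd : no_dd 0 (letters u) by move: ndd.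
have lt_head v : all (ltn^~ k) v -> (head 0 (letters v) < k)%N.
  move=> /allP lt_v; have : {subset letters v <= v}.
    by move=> y; rewrite mem_filter => /andP[].
  by case: (letters v) => //= y l /(_ y (mem_head _ _)) /lt_v.
have blk y v : y != 0%N -> blocked (y :: v) = (head 0 (letters v) < y)%N.
  by move=> y_neq0; rewrite /blocked /letters /= y_neq0 /head_dd /= nth0.
have k_neq0 : k != 0%N by lia.
case bu: (blocked u) => /=; last first.
  rewrite !big_cons big_nil /= (negbTE k_neq0) /= !blk // bu /=.
  have -> : (head 0 (letters (0%N :: u)) < k)%N by apply: lt_head; rewrite /= k_gt0.
  rewrite [X in _ + X = _](_ : _ = \sum_(z <- insertions k m.+1 u)
     z.1 * ((Q / (P + Q)) ^+ nblocked z.2 * G (m.+1 + holes z.2)%N)); last first.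
    rewrite addn1; apply: eq_big_seq => z zu.
    rewrite (negbTE (blocked_insertions lt_u xu (negbT bu) zu)) /= add0n.
    by rewrite add1n addSnnS.
  rewrite IHN // !add0n !add1n pq_numberS !addnS !addSn /= !exprS.
  by field; apply/andP.
(* By [valleys_ok], the letter after a blocked hole is followed by another hole. Putting [k] there
   unblocks the first hole, since [k] exceeds the letter between them. *)
case: u => [|y u] // in lt_uN lt_u xu su vxu vu ndd bu *.
case: y => // y in lt_uN lt_u xu su vxu vu ndd bu *.
move: bu; rewrite blk // => ltuy.
case: u => [|z s] in lt_uN lt_u xu su vxu vu ndd ltuy *; first by [].
case: z => [|z] in lt_uN lt_u xu su vxu vu ndd ltuy *; last first.
  by move: vxu ltuy; rewrite /letters /starts_hole /= orbF; lia.
move: lt_uN lt_u su vu ndd ltuy => /= lt_uN /and3P[lt_yk _ lt_s].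
rewrite {1}/starts_hole /= => /andP[ss sps] /andP[vs vls].
rewrite /letters /= -/(letters s) => /andP[_ ndds] ltsy.
(* Otherwise the first letter of [s], smaller than the letter before the hole, would be a double
   descent. *)
have bs : ~~ blocked s.
  by move: ndds; rewrite /blocked /head_dd nth0; case: (letters s) ltsy => [|a [|b l]] //=; lia.
rewrite big_nil add0r !big_map big_cat bs /= !big_cons big_nil !big_map /=.
rewrite (negbTE bs) (negbTE k_neq0) /= !blk //.
have hk v : head 0 (letters (k :: v)) = k by rewrite /letters /= k_neq0.
have h0 v : letters (0%N :: v) = letters v by [].
rewrite !h0 !hk (lt_head s lt_s) [(k < y.+1)%N]ltnNge (ltnW lt_yk) /=.
(* Insertions further to the right keep the first hole blocked and the second one unblocked. *)
rewrite [X in _ + X = _](_ : _ = Q / (P + Q) *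
    \sum_(z <- insertions k m.+2 s)
     z.1 * ((Q / (P + Q)) ^+ nblocked z.2 * G (m.+2 + holes z.2)%N)); last first.
  rewrite !addn0 !addn1 mulr_sumr; apply: eq_big_seq => z zs.
  rewrite (negbTE (blocked_insertions lt_s ss bs zs)) blk // h0.
  rewrite (head_insertions ss zs) ltsy !add0n !add1n exprS.
  by rewrite -!addSnnS; ring.
rewrite IHN //; first last.
- exact: no_dd_le ndds.
- by apply: leq_trans lt_uN; rewrite ltnS leqW.
rewrite !add0n !addn0 !addn1 !add1n !pq_numberS !addnS !addSn /= !exprS.
by field; apply/andP.
Qed.

End Insertions.

Local Open Scope ring_scope.

(** * Sums over André words *)

Section AndreSums.
Variables (K : fieldType) (P Q T : K).
Hypotheses (Q_neq0 : Q != 0) (PQ_neq0 : P + Q != 0).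

Definition letter_weight (k : nat) (w : seq nat) : K :=
  let w1 := take (index k w) w in
  Q ^+ desc_across k w1 * P ^+ asc_across k (drop (index k w).+1 w)
  * (T / Q) ^+ (k < last 0%N w1)%N.

Lemma sum_insertions_shadow n k u w : (0 < k <= n)%N -> state k u ->
  perm_eq w (iota 1 n) -> andre w ->
  \sum_(z <- insertions P Q T k 0 u) z.1 * (shadow k.+1 w == z.2)%:R
  = letter_weight k w * (shadow k w == u)%:R.
Proof.
move=> /andP[k_gt0 le_kn] su wn aw.
have kw : k \in w by rewrite (perm_mem wn) mem_iota; lia.
have uw : uniq w by rewrite (perm_uniq wn) iota_uniq.
have w_gt0 : all (ltn 0) w by apply/allP => x /(perm_iota_gt0 wn) /andP[].
have ndd := andre_no_dd wn aw.
have nddk := (andreP wn aw) k.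
rewrite /letter_weight; move: uw w_gt0 ndd nddk {wn aw}; case/splitPr: kw => w1 w2.
rewrite cat_uniq /= negb_or all_cat => /and3P[_ /andP[k1 _] /andP[k2 _]] /=.
move=> /and3P[gt1 _ gt2] ndd; rewrite filter_cat /= leqnn => nddk.
rewrite index_cat (negbTE k1) /= eqxx addn0 take_size_cat //.
rewrite -cat_rcons drop_size_cat ?size_rcons // cat_rcons.
have last1 : (k < last 0%N w1)%N = ends_hole (shadow k w1).
  have : last 0%N w1 != k.
    case/lastP: (w1) k1 => [|v x] /=; first by lia.
    by rewrite last_rcons mem_rcons inE negb_or eq_sym => /andP[].
  by rewrite ends_hole_shadow // ltn_neqAle eq_sym => ->.
have lek w' : k \notin w' -> [seq x <- w' | (x <= k)%N] = [seq x <- w' | (x < k)%N].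
  move=> k'; apply: eq_in_filter => x xw'; rewrite leq_eqVlt.
  by case: eqP => // x_k; rewrite -x_k xw' in k'.
rewrite shadowS_split // shadow_merge // desc_across_shadow // asc_across_shadow //.
rewrite last1 sum_insertions_eq ?shadow_lt ?spread_shadow ?(state_lt _ su) ?(state_spread su) //.
  (* As [k] is not a double descent of [w], a larger letter on its left forces one on its right. *)
  rewrite ends_hole_shadow // starts_hole_shadow // => k_last.
  move: (no_dd_catr ndd) => /= /andP[]; move: k_last.
  case/lastP: (w1) k1 => [|v x] /=; rewrite ?last_rcons; first by lia.
  by rewrite mem_rcons inE negb_or; lia.
have -> : blocked (strip_hole (shadow k w2)) = head_dd [seq x <- w2 | (x < k)%N].
  rewrite -(letters_shadow k gt2) /blocked /strip_hole /starts_hole.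
  by case: (shadow k w2) => [|[|x] v].
(* Among the letters up to [k], the one after [k] is not a double descent, so the hole is
   unblocked. *)
move: nddk; rewrite (lek _ k1) (lek _ k2) => /no_dd_max; rewrite /= k_gt0 filter_all.
move=> /(_ isT); case: (head_dd _) => //=.
have := filter_all (fun x => (x < k)%N) w2.
by case: [seq x <- w2 | (x < k)%N] => /= [|x v]; lia.
Qed.

Lemma shadow_all k w : all (ltn^~ k) w -> shadow k w = w.
Proof. by elim: w => //= x w IHw /andP[-> /IHw ->]. Qed.

Lemma letters_holes0 u : holes u = 0%N -> letters u = u.
Proof.
move=> /eqP; rewrite -leqn0 leqNgt -has_count => nh; apply/all_filterP.
by apply/allP => x xu; apply: contra nh => x0; apply/hasP; exists x.
Qed.

Lemma nblocked_holes0 u : holes u = 0%N -> nblocked u = 0%N.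
Proof.
by elim: u => //= x u IHu /eqP; rewrite addn_eq0 => /andP[+ /eqP/IHu ->]; case: (x == 0%N).
Qed.

(** Here [N] letters remain and [h] holes are open, none of them blocked. At [h = 0] the clipped
    [h.-1] is harmless because [pq_number] vanishes at 0. *)
Fixpoint paths (N h : nat) : K :=
  if N is M.+1 then
    pq_number P Q h * (paths M h.-1 + paths M h + T / (P + Q) * paths M h.+1)
  else (h == 0%N)%:R.

(** Induction on the number of letters left: the words with shadow [u] are sorted by their next
    shadow, an insertion of [k] into [u], and [sum_insertions] evaluates the sum with
    [G = paths N]. *)
Lemma sum_shadow n N k u : (0 < k)%N -> (k + N = n.+1)%N -> state k u ->
  \sum_(w <- permutations (iota 1 n) | (shadow k w == u) && andre w)
     \prod_(k <= j < n.+1) letter_weight j w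
  = (Q / (P + Q)) ^+ nblocked u * paths N (holes u).
Proof.
elim: N k u => [|N IHN] k u k_gt0 kN su.
  rewrite addn0 in kN; rewrite {}kN in k_gt0 su *.
  have shE w : w \in permutations (iota 1 n) -> shadow n.+1 w = w.
    rewrite mem_permutations => wn; apply: shadow_all; apply/allP => x.
    by move=> /(perm_iota_gt0 wn) /=; lia.
  have [hu|hu] := eqVneq (holes u) 0%N => /=; last first.
    rewrite (negbTE hu) mulr0 big1_seq // => w /andP[/andP[/eqP su' _] wn].
    rewrite shE // in su'; case/negP: hu; rewrite -su' /holes.
    rewrite mem_permutations in wn; rewrite -leqn0 leqNgt -has_count; apply/hasP.
    by case=> x /(perm_iota_gt0 wn) + /eqP x0; rewrite x0.
  rewrite hu eqxx mulr1 nblocked_holes0 // expr0.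
  have un : perm_eq u (iota 1 n) by rewrite -{1}(letters_holes0 hu) (state_perm su).
  have au : andre u by apply/(andreP un); rewrite -(letters_holes0 hu); apply: state_andre su.
  transitivity (\sum_(w <- permutations (iota 1 n) | w == u) 1 : K).
    rewrite big_seq_cond [RHS]big_seq_cond; apply: eq_big => [w|w _]; last by rewrite big_geq.
    case wn: (w \in _) => //=; rewrite shE //.
    by case: eqP => // ->.
  rewrite big_mkcond (bigD1_seq u) ?permutations_uniq ?mem_permutations //= eqxx.
  by rewrite big1 ?addr0 // => w /negbTE->.
transitivity (\sum_(w <- permutations (iota 1 n) | andre w)
    \sum_(z <- insertions P Q T k 0 u) z.1 * (shadow k.+1 w == z.2)%:R
      * \prod_(k.+1 <= j < n.+1) letter_weight j w).
  rewrite big_mkcondl /= big_seq_cond [RHS]big_seq_cond; apply: eq_bigr => w.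
  rewrite mem_permutations => /andP[wn aw].
  rewrite -mulr_suml (sum_insertions_shadow (n := n)) //; last by lia.
  rewrite big_ltn; last by lia.
  by case: eqP; rewrite ?mulr1 // mulr0 mul0r.
rewrite exchange_big /=.
transitivity (\sum_(z <- insertions P Q T k 0 u)
    z.1 * ((Q / (P + Q)) ^+ nblocked z.2 * paths N (0 + holes z.2)%N)).
  apply: eq_big_seq => z zu; rewrite -(IHN k.+1) //; first last.
  - exact: state_insertions zu.
  - by rewrite addSnnS.
  rewrite mulr_sumr big_mkcondl; apply: eq_bigr => w _.
  by rewrite -mulrA; case: eqP; rewrite ?mul1r // mul0r mulr0.
rewrite sum_insertions // ?(state_lt _ su) ?(state_spread su) ?(state_valleys su) //.
  by rewrite expr0 mul1r !add0n mulrA.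
have := state_andre su k; rewrite (all_filterP _) //.
by apply/allP => x /(perm_iota_gt0 (state_perm su)); lia.
Qed.

(** Before the letter 1 is read, every nonempty word is a single unblocked hole. *)
Lemma sum_andre_paths n : (0 < n)%N ->
  \sum_(w <- permutations (iota 1 n) | andre w)
     \prod_(1 <= j < n.+1) letter_weight j w
  = paths n 1.
Proof.
move=> n_gt0; have s0 : state 1 [:: 0%N] by split.
have := sum_shadow (n := n) (N := n) (k := 1) isT (add1n n) s0.
rewrite /= /holes /= addn0 expr0 mul1r => <-.
rewrite big_seq_cond [RHS]big_seq_cond; apply: eq_bigl => w.
case wn: (w \in _) => //=; suff -> : shadow 1 w = [:: 0%N] by [].
rewrite mem_permutations in wn.
have : size w = n by rewrite (perm_size wn) size_iota.
have : all (ltn 0) w by apply/allP => x /(perm_iota_gt0 wn) /andP[].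
elim: w n n_gt0 {wn} => [|x w IHw] n n_gt0 /=; first by lia.
move=> /andP[x_gt0 w_gt0] _; rewrite ltnS leqNgt x_gt0 /=.
by case: w IHw w_gt0 => // y w IHw w_gt0; rewrite (IHw (size w).+1).
Qed.

End AndreSums.

(** * Motzkin paths and J-fractions *)

Section MotzkinPaths.
Variable K : fieldType.
Implicit Types f g : fps K.

(** Truncation to polynomials transfers commutativity and associativity to series. *)
Lemma fps_mul_poly f g N n : (n < N)%N ->
  fps_mul f g n = (\poly_(i < N) f i * \poly_(i < N) g i)`_n.
Proof.
move=> lt_nN; rewrite coefM; apply: eq_bigr => -[i /= lt_in] _.
by rewrite !coef_poly !ifT //; lia.
Qed.

Lemma eq_fps_mul f f' g g' n :
  (forall i, (i <= n)%N -> f i = f' i) -> (forall i, (i <= n)%N -> g i = g' i) ->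
  fps_mul f g n = fps_mul f' g' n.
Proof.
by move=> ff gg; apply: eq_bigr => i _; rewrite ff ?gg ?leq_subr // -ltnS.
Qed.

Lemma fps_mulSl f g n :
  fps_mul f g n.+1 = f 0 * g n.+1 + fps_mul (fun i => f i.+1) g n.
Proof. by rewrite /fps_mul big_ord_recl. Qed.

Lemma fps_mulC f g n : fps_mul f g n = fps_mul g f n.
Proof. by rewrite !(fps_mul_poly _ _ (ltnSn n)) mulrC. Qed.

Lemma fps_mulA f g (h : fps K) n : fps_mul f (fps_mul g h) n = fps_mul (fps_mul f g) h n.
Proof.
transitivity ((\poly_(i < n.+1) f i * (\poly_(i < n.+1) g i * \poly_(i < n.+1) h i))`_n).
  rewrite coefM; apply: eq_bigr => i _.
  by rewrite coef_poly ltn_ord (fps_mul_poly _ _ (N := n.+1)) // ltnS leq_subr.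
rewrite mulrA coefM; apply: eq_bigr => i _.
by rewrite coef_poly ltnS leq_subr (fps_mul_poly _ _ (N := n.+1)).
Qed.

Variables b u v l : nat -> K.
Hypothesis lE : forall m, l m.+1 = u m * v m.+1.

Let J (m : nat) : fps K := fun n => Jconv b l n.+1 m n.

Lemma Jconv0 m : J m 0 = 1.
Proof. by rewrite /J /= fps_invE /= big_ord0 invr1 subr0 mul1r. Qed.

(** Coefficient form of [J_m = 1 + b_m x J_m + l_(m+1) x^2 J_m J_(m+1)], obtained by clearing the
    denominator. *)
Lemma JconvS m n : J m n.+1 = b m * J m n
  + (if n is n'.+1 then l m.+1 * fps_mul (J m) (J m.+1) n' else 0).
Proof.
rewrite {1}/J [Jconv _ _ _ _]/= fps_invE [Jdenom _ _ _ 0]/= invr1 mul1r sub0r.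
rewrite big_ord_recr /= subSn // subnn /= opprD mulrN opprK addrC.
rewrite -[fps_inv _]/(Jconv b l n.+2 m) Jconv_stable // mulrC; congr (_ + _).
case: n => [|n]; first by rewrite big_ord0 oppr0.
rewrite -sumrN mulr_sumr; apply: eq_bigr => i _; have lt_in := ltn_ord i.
rewrite Jconv_stable; last by lia.
have -> : (n.+2 - i = (n - i).+2)%N by lia.
rewrite /= -/(Jconv b l n.+2 m.+1) Jconv_stable; last by lia.
by rewrite /J /=; ring.
Qed.

Lemma Jconv1 m : J m 1 = b m.
Proof. by rewrite JconvS Jconv0 mulr1 addr0. Qed.

(** Weighted Motzkin paths of [N] steps from level [h] down to level 0, by first step; every step
    weight is indexed by its starting level. *)
Fixpoint motzkin (N h : nat) : K :=
  if N is M.+1 then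
    b h * motzkin M h + (if h is h'.+1 then v h * motzkin M h' else 0)
    + u h * motzkin M h.+1
  else (h == 0%N)%:R.

(* A path from level [h.+1] to level [0] first stays weakly above [h.+1], then
   steps down to [h]. *)
Lemma motzkin_first_passage n h :
  motzkin n.+1 h.+1 = v h.+1 * fps_mul (J h.+1) (motzkin^~ h) n.
Proof.
elim/ltn_ind: n h => -[|[|n]] IHn h.
- by rewrite /= /fps_mul big_ord1 /= Jconv0; ring.
- rewrite /fps_mul !big_ord_recl big_ord0 /= Jconv1 Jconv0; ring.
(* Up to the factor [v h.+1], the three terms correspond to a first step that goes down, stays level
   or goes up. *)
have -> : fps_mul (J h.+1) (motzkin^~ h) n.+2 =
    motzkin n.+2 h + b h.+1 * fps_mul (J h.+1) (motzkin^~ h) n.+1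
    + l h.+2 * fps_mul (fps_mul (J h.+1) (J h.+2)) (motzkin^~ h) n.
  rewrite !fps_mulSl Jconv1 !Jconv0 [X in _ + (_ + X)](_ : _ =
    b h.+1 * fps_mul (fun i => J h.+1 i.+1) (motzkin^~ h) n
    + l h.+2 * fps_mul (fps_mul (J h.+1) (J h.+2)) (motzkin^~ h) n); first by ring.
  rewrite /fps_mul !mulr_sumr -big_split /=; apply: eq_bigr => i _.
  by rewrite JconvS -/(fps_mul _ _ _); ring.
have -> : motzkin n.+3 h.+1 = b h.+1 * motzkin n.+2 h.+1
    + v h.+1 * motzkin n.+2 h + u h.+1 * motzkin n.+2 h.+2 by [].
rewrite !IHn // lE.
(* After an up step come two successive first passages. The term of length 0 vanishes, as level
   [h.+1] is not 0. *)
have -> : fps_mul (J h.+2) (motzkin^~ h.+1) n.+1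
    = v h.+1 * fps_mul (J h.+2) (fps_mul (J h.+1) (motzkin^~ h)) n.
  rewrite /fps_mul big_ord_recr /= subnn mulr0 addr0 mulr_sumr.
  apply: eq_bigr => i _; have lt_in := ltn_ord i; rewrite subSn // IHn; last by lia.
  by rewrite mulrCA.
rewrite fps_mulA; have -> : fps_mul (fps_mul (J h.+2) (J h.+1)) (motzkin^~ h) n
    = fps_mul (fps_mul (J h.+1) (J h.+2)) (motzkin^~ h) n.
  by apply: eq_fps_mul => // i _; apply: fps_mulC.
ring.
Qed.

Lemma motzkin_Jfrac n : motzkin n 0 = Jfrac b l n.
Proof.
rewrite -[RHS]/(J 0 n); elim/ltn_ind: n => -[|n] IHn; first by rewrite Jconv0.
rewrite JconvS [LHS]/= addr0 -/motzkin IHn //; congr (_ + _).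
case: n => [|n] in IHn *; first by rewrite /= mulr0.
rewrite motzkin_first_passage lE mulrA fps_mulC; congr (_ * _).
by apply: eq_fps_mul => // i le_in; rewrite IHn //; lia.
Qed.

End MotzkinPaths.

(** Level [h] stands for [h.+1] holes. No letter can be placed once no hole is left, so the last
    letter closes the only hole, a step of weight [[1] = 1] that is removed. *)
Lemma paths_motzkin (K : fieldType) (P Q T : K) N h :
  paths P Q T N.+1 h.+1 =
  motzkin (fun m => pq_number P Q m.+1) (fun m => pq_number P Q m.+1 * (T / (P + Q)))
          (fun m => pq_number P Q m.+1) N h.
Proof.
have pq0 : pq_number P Q 0 = 0 by rewrite /pq_number big_ord0.
elim: N h => [|N IHN] h.
  rewrite /= addr0 mulr0 addr0; case: h => [|h]; rewrite ?mulr0 //.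
  by rewrite mulr1 pq_numberS pq0 mulr0 addr0 expr0.
have -> : paths P Q T N.+2 h.+1 = pq_number P Q h.+1 *
  (paths P Q T N.+1 h + paths P Q T N.+1 h.+1 + T / (P + Q) * paths P Q T N.+1 h.+2) by [].
rewrite !IHN; case: h => [|h]; last by rewrite IHN /=; ring.
by rewrite [paths _ _ _ _ 0]/= pq0 mul0r /=; ring.
Qed.

(** * The theorem *)

Lemma word_perm n (s : 'S_n) : perm_eq (word s) (iota 1 n).
Proof.
apply: uniq_perm; rewrite ?iota_uniq //.
  rewrite map_inj_uniq ?enum_uniq // => i j [] /val_inj; exact: perm_inj.
move=> x; rewrite mem_iota; apply/mapP/idP => [[i _ ->]|x_n]; first by have := ltn_ord (s i); lia.
have lt_x : (x.-1 < n)%N by lia.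
by exists (s^-1%g (Ordinal lt_x)); rewrite ?mem_enum // permKV /=; lia.
Qed.

Lemma word_inj n : injective (@word n).
Proof.
move=> s1 s2 /eq_in_map eqs; apply/permP => i; apply: val_inj.
by have [] := eqs i (mem_enum _ _).
Qed.

Lemma sum_words (K : fieldType) n (A : pred (seq nat)) (F : seq nat -> K) :
  \sum_(s : 'S_n | A (word s)) F (word s)
  = \sum_(w <- permutations (iota 1 n) | A w) F w.
Proof.
have wu : uniq [seq word s | s : 'S_n] by rewrite map_inj_uniq ?enum_uniq //; apply: word_inj.
have sub : {subset [seq word s | s : 'S_n] <= permutations (iota 1 n)}.
  by move=> w /mapP[s _ ->]; rewrite mem_permutations word_perm.
rewrite -(perm_big _ (uniq_perm wu (permutations_uniq _) _)); last first.
  apply uniq_min_size => //.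
  by rewrite size_permutations ?iota_uniq // size_iota size_map -cardE card_Sn.
by rewrite big_map big_enum_cond.
Qed.

(** Each pattern 31-2 or 2-13 is counted at its letter 2 and each descent at its bottom, with weight
    [T / Q]. *)
Lemma prod_letter_weight (K : fieldType) (P Q T : K) n w : Q != 0 ->
  perm_eq w (iota 1 n) ->
  \prod_(1 <= k < n.+1) letter_weight P Q T k w
  = P ^+ res w * Q ^ ((les w)%:Z - (des w)%:Z) * T ^+ des w.
Proof.
move=> Q_neq0 wn; rewrite !big_split /= -!expr_sum.
have := les_sum w; rewrite (sum_letters (fun k i => desc_across k (take i w)) wn) => <-.
have := res_sum w; rewrite (sum_letters (fun k i => asc_across k (drop i.+1 w)) wn) => <-.
have := des_sum w.
rewrite (sum_letters (fun k i => (k < last 0 (take i w)) : nat)%N wn) => <-.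
rewrite expfzDr // -invr_expz -!exprnP expr_div_n.
by ring.
Qed.

Lemma sum_andre_word (K : fieldType) (P Q T : K) n :
  Q != 0 -> P + Q != 0 -> (0 < n)%N ->
  \sum_(s in Andre n) P ^+ res (word s)
     * Q ^ ((les (word s))%:Z - (des (word s))%:Z) * T ^+ des (word s)
  = Jfrac (fun m => pq_number P Q m.+1)
      (fun m => pq_number P Q m.+1 * pq_number P Q m / (P + Q) * T) n.-1.
Proof.
move=> Q_neq0 PQ_neq0 n_gt0.
rewrite -(@motzkin_Jfrac _ _ (fun m => pq_number P Q m.+1 * (T / (P + Q)))
  (fun m => pq_number P Q m.+1)); last by move=> m; ring.
rewrite -paths_motzkin prednK // -sum_andre_paths //.
under eq_bigl => s do rewrite inE.
rewrite (sum_words n andre (fun w => P ^+ res w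
     * Q ^ ((les w)%:Z - (des w)%:Z) * T ^+ des w)).
rewrite big_seq_cond [RHS]big_seq_cond; apply: eq_bigr => w.
by rewrite mem_permutations => /andP[wn _]; rewrite (prod_letter_weight _ _ _ wn).
Qed.

Lemma eq_Jfrac (K : fieldType) (b b' l l' : nat -> K) n :
  b =1 b' -> l =1 l' -> Jfrac b l n = Jfrac b' l' n.
Proof.
move=> eb el; rewrite /Jfrac; move: (n.+1) (0%N) => N m.
elim: N m n => // N IHN m n; apply: eq_fps_inv => -[|[|i]] _ //; first by rewrite /Jdenom eb.
by rewrite /Jdenom el; congr (- (_ * _)); apply: IHN.
Qed.

Lemma pqnumE n : pqnum n = pq_number p q n.
Proof.
rewrite /pqnum (exchange_big_dep xpredT) //=; apply: eq_bigr => g _.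
have lt_n : (n.-1 - g < n)%N by have := ltn_ord g; lia.
rewrite (big_pred1 (Ordinal lt_n)) => [|i]; first by rewrite mulrC.
have lt_in := ltn_ord i; have lt_gn := ltn_ord g.
by rewrite /= -val_eqE /=; lia.
Qed.

Lemma q_neq0 : q != 0.
Proof.
rewrite tofrac_eq0; apply/eqP => /(congr1 (mcoeff U_(Ordinal (isT : 1 < 3)%N))).
by rewrite mcoeffXU mcoeff0 eqxx.
Qed.

Lemma pq_neq0 : p + q != 0.
Proof.
rewrite -tofracD tofrac_eq0.
apply/eqP => /(congr1 (mcoeff U_(Ordinal (isT : 1 < 3)%N))).
by rewrite mcoeffD !mcoeffXU mcoeff0 eqxx.
Qed.

Lemma pqbinom2E m : pqbinom m.+1 2 = pq_number p q m.+1 * pq_number p q m / (p + q).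
Proof.
rewrite /pqbinom !big_ord_recl !big_ord0 /= subn0 subSS subn0 !mulr1 !pqnumE.
(* The denominator is [[1] [2] = p + q]. *)
congr (_ / _); rewrite !pq_numberS /pq_number big_ord0; ring.
Qed.

Theorem theorem1p7 (n : nat) (hn : (1 <= n)%N) :
  D n = \sum_(0 <= k < ((n - 1) %/ 2).+1) d n k * t ^+ k
  /\
  \sum_(0 <= k < ((n - 1) %/ 2).+1) d n k * t ^+ k
    = \sum_(s in Andre n)
        p ^+ res (word s)
        * q ^ ((les (word s))%:Z - (des (word s))%:Z)
        * t ^+ des (word s).
Proof.
have dE : \sum_(0 <= k < ((n - 1) %/ 2).+1) d n k * t ^+ k
    = \sum_(s in Andre n)
        p ^+ res (word s)
        * q ^ ((les (word s))%:Z - (des (word s))%:Z)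
        * t ^+ des (word s).
  rewrite big_mkord.
  (* The truncation by [inord] is faithful on André permutations by [des_andre_le]. *)
  rewrite [RHS](partition_big
    (fun s => inord (des (word s)) : 'I_((n - 1) %/ 2).+1) xpredT) //=.
  apply: eq_bigr => k _; rewrite /d mulr_suml.
  have desE s : s \in Andre n ->
      (inord (des (word s)) == k :> 'I_((n - 1) %/ 2).+1) = (des (word s) == k).
    rewrite inE => aw; rewrite -val_eqE /= inordK // ltnS.
    exact: des_andre_le hn (word_perm s) aw.
  apply: eq_big => [s|s]; rewrite inE; first by case: (boolP (s \in _)) => //= /desE.
  by move=> /andP[_ /eqP ->].
split=> //; rewrite dE (sum_andre_word _ q_neq0 pq_neq0) // /D.
by apply: eq_Jfrac => m; rewrite ?pqnumE ?pqbinom2E.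
Qed.
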